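(* Let $q$ be a prime power. For all integers $n \ge d \ge 1$, the Whitney numbers of $\mathcal{H}(q,n,d)$ and $\mathcal{H}(q,n,n-d)$ satisfy $$\sum_{i=0}^{n-d} \begin{bmatrix} n-i \\ d \end{bmatrix}_q w_i(q,n,d) \ = \ \sum_{i=0}^{d} \begin{bmatrix} n-i \\ d-i \end{bmatrix}_q w_i(q,n,n-d).$$
   Context: $\begin{bmatrix} r\\ s\end{bmatrix}_q$ is the $q$-binomial coefficient ($0$ if $s<0$ or $s>r$). The Hamming weight of $v \in \mathbb{F}_q^n$ is the number of its nonzero coordinates. For integers $n\ge 1$ and $d\ge 0$, the higher-weight Dowling lattice $\mathcal{H}(q,n,d)$ is the set, ordered by inclusion, of all $\mathbb{F}_q$-linear subspaces of $\mathbb{F}_q^n$ that have a basis made of vectors of Hamming weight at most $d$, together with the zero space (so $\mathcal{H}(q,n,0)$ is the one-element lattice $\{\{0\}\}$). It is a finite geometric lattice whose rank function is the $\mathbb{F}_q$-dimension. With $\mu$ the Möbius function of $\mathcal{H}(q,n,d)$, the $i$-th Whitney number (of the first kind) is $w_i(q,n,d)=\sum_{U \in \mathcal{H}(q,n,d),\ \dim U=i} \mu(\{0\},U)$ (an empty sum is $0$). *)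

(* Defs.v *)
From HB Require Import structures.
From mathcomp Require Import all_boot all_order all_algebra.

Set Implicit Arguments.
Unset Strict Implicit.
Unset Printing Implicit Defensive.

Import Order.TTheory GRing.Theory Num.Theory.
Local Open Scope ring_scope.

(* The quotient of naturals is exact for q > 1: see qbinom_mul. *)
Definition qbinom (q r s : nat) : nat :=
  if (s <= r)%N then
    ((\prod_(i < s) (q ^ (r - i) - 1)) %/ (\prod_(i < s) (q ^ i.+1 - 1)))%N
  else 0%N.

Fixpoint qpascal (q r s : nat) : nat :=
  match r, s with
  | _, 0 => 1
  | 0, _.+1 => 0
  | r'.+1, s'.+1 => qpascal q r' s' + q ^ s * qpascal q r' s
  end%N.

Lemma qpascal_small q r s : (r < s)%N -> qpascal q r s = 0%N.
Proof.
elim: r s => [|r IHr] [|s] //= lt_rs.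
by rewrite !IHr ?muln0 // ltnW.
Qed.

Lemma qpascal_mul q r s : (1 < q)%N ->
  (qpascal q r s * \prod_(i < s) (q ^ i.+1 - 1) =
   \prod_(i < s) (q ^ (r - i) - 1))%N.
Proof.
move=> q_gt1; elim: r s => [|r IHr] [|s]; rewrite ?big_ord0 //.
  by rewrite [RHS]big_ord_recl mul0n subnn.
have [lt_rs|le_sr] := ltnP r s.
  rewrite qpascal_small // mul0n.
  by rewrite (bigD1 (Ordinal (lt_rs : r.+1 < s.+1)%N)) //= subnn mul0n.
have shift : (\prod_(i < s.+1) (q ^ (r.+1 - i) - 1) =
    (q ^ r.+1 - 1) * \prod_(i < s) (q ^ (r - i) - 1))%N.
  by rewrite big_ord_recl subn0.
rewrite shift /= mulnDl {1}big_ord_recr /= mulnA IHr -mulnA IHr.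
rewrite [X in (_ + _ * X)%N]big_ord_recr /=.
rewrite [(q ^ s.+1 * _)%N]mulnCA -mulnDr mulnC; congr (_ * _)%N.
have q_gt0 := ltnW q_gt1.
rewrite mulnBr muln1 -expnD addSn subnKC //.
rewrite addnC addnBA ?expn_gt0 ?q_gt0 // subnK //.
by rewrite leq_exp2l // ltnS.
Qed.

Lemma qbinom_mul q r s : (1 < q)%N -> (s <= r)%N ->
  (qbinom q r s * \prod_(i < s) (q ^ i.+1 - 1) =
   \prod_(i < s) (q ^ (r - i) - 1))%N.
Proof.
move=> q_gt1 le_sr; rewrite /qbinom le_sr divnK //.
by rewrite -(qpascal_mul r s q_gt1) dvdn_mull.
Qed.

Section Mobius.
Variables (disp : Order.disp_t) (P : finPOrderType disp).
Implicit Types x y z : P.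

(* The recursion is bounded by k; k = #|P| always suffices, so that mobius is
   characterised by mobiusxx, mobius_lt and mobius_nle. *)
Fixpoint mobius_upto (k : nat) (x y : P) : int :=
  if k is k'.+1 then
    if x == y then 1
    else if (x < y)%O then
      - \sum_(z | (x <= z)%O && (z < y)%O) mobius_upto k' x z
    else 0
  else 0.

Definition mobius (x y : P) : int := mobius_upto #|P| x y.

Lemma card_gt0 x : (0 < #|P|)%N.
Proof. by apply/card_gt0P; exists x. Qed.

Lemma mobius_upto_stable k l x y :
  (#|[set z | (z < y)%O]| < k)%N -> (#|[set z | (z < y)%O]| < l)%N ->
  mobius_upto k x y = mobius_upto l x y.
Proof.
elim: k l y => [|k IHk] [|l] y //= lt_k lt_l.
case: eqP => // _; case: ifP => // _; congr (- _).
apply: eq_bigr => z /andP[_ lt_zy].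
have lt_card : (#|[set t | (t < z)%O]| < #|[set t | (t < y)%O]|)%N.
  apply: proper_card; apply/properP; split.
    by apply/subsetP => t; rewrite !inE => /lt_trans; apply.
  by exists z; rewrite !inE ?ltxx.
by apply: IHk; apply: leq_trans lt_card _.
Qed.

Lemma mobiusxx x : mobius x x = 1.
Proof. by rewrite /mobius; case: #|P| (card_gt0 x) => //= k _; rewrite eqxx. Qed.

Lemma mobius_nle x y : ~~ (x <= y)%O -> mobius x y = 0.
Proof.
rewrite le_eqVlt negb_or /mobius => /andP[/negPf nxy /negPf ltxy].
by case: #|P| => //= k; rewrite nxy ltxy.
Qed.

Lemma mobius_lt x y : (x < y)%O ->
  mobius x y = - \sum_(z | (x <= z)%O && (z < y)%O) mobius x z.
Proof.
move=> lt_xy.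
have lt_card z : (#|[set t | (t < z)%O]| < #|P|)%N.
  rewrite -cardsT; apply: proper_card; apply/properP; split => //.
  by exists z; rewrite !inE ?ltxx.
have -> : mobius x y = mobius_upto #|P|.+1 x y.
  by apply: mobius_upto_stable; rewrite // ltnS ltnW.
by rewrite /= (lt_eqF lt_xy) lt_xy.
Qed.

End Mobius.

Definition hweight (F : fieldType) (n : nat) (v : 'rV[F]_n) : nat :=
  #|[set i | v 0 i != 0]|.

Section VspaceFinite.
(* Only here is the matrix encoding of {vspace vT} a canonical subType. *)
Import VectorInternalTheory.

HB.instance Definition _ (F : finFieldType) (vT : vectType F) :=
  [Finite of {vspace vT} by <:].

End VspaceFinite.

Section HigherWeightDowling.
Variables (F : finFieldType) (n d : nat).

Definition low_weight_generated : pred {vspace 'rV[F]_n} := fun U =>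
  (U == 0%VS) ||
  [exists b : (\dim U).-tuple 'rV[F]_n,
     basis_of U b && all (fun v => (hweight v <= d)%N) b].

Definition hwd_lattice : Type := {U : {vspace 'rV[F]_n} | low_weight_generated U}.

HB.instance Definition _ := Finite.on hwd_lattice.

Definition hwd_le (U V : hwd_lattice) : bool := (val U <= val V)%VS.

Lemma hwd_le_refl : reflexive hwd_le.
Proof. by move=> U; apply: subvv. Qed.

Lemma hwd_le_anti : antisymmetric hwd_le.
Proof. by move=> U V UV; apply/val_inj/eqP; rewrite eqEsubv. Qed.

Lemma hwd_le_trans : transitive hwd_le.
Proof. by move=> V U W; apply: subv_trans. Qed.

Fact hwd_display : Order.disp_t. Proof. exact: Order.Disp tt tt. Qed.

HB.instance Definition _ :=
  Order.Le_isPOrder.Build hwd_display hwd_lattice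
    hwd_le_refl hwd_le_anti hwd_le_trans.

Lemma low_weight_generated0 : low_weight_generated 0%VS.
Proof. by rewrite /low_weight_generated eqxx. Qed.

Definition hwd0 : hwd_lattice := Sub 0%VS low_weight_generated0.

Lemma hwd_le0x (U : hwd_lattice) : (hwd0 <= U)%O.
Proof. exact: sub0v. Qed.

HB.instance Definition _ :=
  Order.hasBottom.Build hwd_display hwd_lattice hwd_le0x.

Definition whitney (i : nat) : int :=
  \sum_(U : hwd_lattice | \dim (val U) == i) mobius hwd0 U.

End HigherWeightDowling.

(* Main.v *)
Require Import Defs.
From mathcomp Require Import all_boot all_order all_algebra all_field.

(** Both sides count linear MDS codes of length n: the left one those of
dimension n - d, the right one those of dimension d. Orthogonality is a
bijection between the two families.

Write H for the lattice of subspaces of F^n generated by words of weight at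
most e. Inside a subspace V, the members of H have a largest element M, the
span of the words of V of weight at most e. Hence the sum of mu(0, U) over the
U in H with U <= V is the sum of mu(0, U) over the interval [0, M]; it is 1 if
M = 0, that is, if every nonzero word of V has weight greater than e, and 0
otherwise (mobius_sum_sub). Summing over all V of dimension k and exchanging
the sums, the number of such codes V is the sum over U of mu(0, U) times the
number of k-dimensional V above U. That number is the Gaussian binomial
[n - dim U; k - dim U] (card_sup_dim), so grouping the U by dimension expresses
the number of codes through the Whitney numbers (card_codes).

With e = d and k = n - d this is the left-hand side, up to the symmetry of the
Gaussian binomial (qbinom_sym); with e = n - d and k = d it is the right-hand
side. A code of dimension n - d without nonzero words of weight at most d
attains the Singleton bound, and its dual has dimension d and no nonzero word
of weight at most n - d (min_weight_gt_perp), whence card_codes_dual. *)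

Set Implicit Arguments.
Unset Strict Implicit.
Unset Printing Implicit Defensive.

Import Order.TTheory GRing.Theory Num.Theory.

Local Open Scope ring_scope.

(** * Counting the subspaces above a given one *)

Section Counting.
Variables (F : finFieldType) (n : nat).
Implicit Types (U V W : {vspace 'rV[F]_n}) (v : 'rV[F]_n).

Lemma dim_rV : \dim {:'rV[F]_n} = n.
Proof. by rewrite dimvf dim_matrix mul1r. Qed.

Lemma dimv_le_length V : (\dim V <= n)%N.
Proof. by rewrite -[leqRHS]dim_rV dimvS ?subvf. Qed.

Lemma dim_add_line V v : v \notin V -> \dim (V + <[v]>) = (\dim V).+1.
Proof.
move=> nVv; rewrite dimv_disjoint_sum.
  rewrite dim_vline; case: eqP nVv => [->|_ _]; first by rewrite mem0v.
  by rewrite addn1.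
apply/eqP; rewrite -subv0; apply/subvP=> w /memv_capP[Vw /vlineP[c wE]].
rewrite memv0; apply: contraNT nVv => w0.
have c0 : c != 0 by apply: contra_neq w0 => c0; rewrite wE c0 scale0r.
by rewrite -[v](scalerK c0) -wE memvZ.
Qed.

Lemma card_vspaceD U V :
  (U <= V)%VS ->
  #|[set v | (v \notin U) && (v \in V)]| = (#|F| ^ \dim V - #|F| ^ \dim U)%N.
Proof.
move=> UV; rewrite -!card_vspace -(cardsE (mem V)) -(cardsE (mem U)) -cardsDS.
  by apply: eq_card => v; rewrite !inE.
by apply/subsetP=> v; rewrite !inE; apply: (subvP UV).
Qed.

(** Double counting of the pairs (V, v) with V above U of dimension k and v in V
outside U: choosing v first, V ranges over the subspaces above U + <[v]>, which
is one dimension larger than U. *)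
Lemma card_sup_dim_rec U k :
  (#|[set V | (U <= V)%VS && (\dim V == k)]| * (#|F| ^ k - #|F| ^ \dim U) =
  \sum_(v | v \notin U) #|[set V | (U + <[v]> <= V)%VS && (\dim V == k)]|)%N.
Proof.
rewrite -sum_nat_const.
transitivity (\sum_(V in [set V | (U <= V)%VS && (\dim V == k)])
                \sum_(v | (v \notin U) && (v \in V)) 1)%N.
  apply: eq_bigr => V; rewrite inE => /andP[UV /eqP <-].
  by rewrite sum1dep_card card_vspaceD.
rewrite (exchange_big_dep (fun v => v \notin U)) /=; last first.
  by move=> V v _ /andP[].
apply: eq_bigr => v nUv; rewrite sum1dep_card.
by apply: eq_card => V; rewrite !inE nUv subv_add andbAC.
Qed.

(** The product formula for Gaussian binomials, kept free of divisions so that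
each step of card_sup_dim_rec contributes one factor to each product. *)
Lemma card_sup_dim_mul U s :
  (#|[set V | (U <= V)%VS && (\dim V == \dim U + s)]| *
     \prod_(j < s) (#|F| ^ j.+1 - 1) =
   \prod_(j < s) (#|F| ^ (n - \dim U - j) - 1))%N.
Proof.
have q_gt0 : (0 < #|F|)%N by apply: ltnW; apply: finNzRing_gt1.
elim: s U => [|s IHs] U.
  rewrite !big_ord0 muln1 addn0.
  rewrite -[RHS](cards1 U).
  apply: eq_card => V.
  rewrite !inE; apply/andP/eqP => [[UV /eqP dV]|->]; last by rewrite subvv eqxx.
  by apply/eqP; rewrite eq_sym eqEdim UV dV leqnn.
(* The recurrence carries the factor q ^ k - q ^ dim U, which is the wanted
   q ^ s.+1 - 1 up to a power of q; so multiply both sides by that power. *)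
apply/eqP; rewrite -(eqn_pmul2l (_ : 0 < #|F| ^ \dim U)%N) ?expn_gt0 ?q_gt0 //.
apply/eqP.
rewrite big_ord_recr big_ord_recl /= subn0.
have shrink a : (#|F| ^ \dim U * (#|F| ^ a - 1) =
    #|F| ^ (\dim U + a) - #|F| ^ \dim U)%N by rewrite mulnBr muln1 expnD.
transitivity ((#|[set V | (U <= V)%VS && (\dim V == \dim U + s.+1)]| *
   (#|F| ^ (\dim U + s.+1) - #|F| ^ \dim U)) *
   \prod_(j < s) (#|F| ^ j.+1 - 1))%N.
  rewrite -shrink [X in _ = (X * _)%N]mulnCA -[RHS]mulnA; congr (_ * _)%N.
  by rewrite mulnA mulnAC.
rewrite card_sup_dim_rec big_distrl /=.
rewrite (eq_bigr (fun=> \prod_(j < s) (#|F| ^ (n - \dim U - j.+1) - 1)))%N.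
  rewrite sum_nat_const mulnA shrink subnKC ?dimv_le_length //; congr (_ * _)%N.
  have := card_vspaceD (subvf U); rewrite dim_rV => <-.
  by apply: eq_card => v; rewrite !inE memvf andbT.
move=> v nUv; rewrite -addSnnS -(dim_add_line nUv) IHs.
by apply: eq_bigr => j _; rewrite (dim_add_line nUv) -!subnDA addSnnS.
Qed.

Lemma card_sup_dim U k : (\dim U <= k)%N ->
  #|[set V | (U <= V)%VS && (\dim V == k)]| =
  qbinom #|F| (n - \dim U) (k - \dim U).
Proof.
move=> leUk; have q_gt1 : (1 < #|F|)%N by apply: finNzRing_gt1.
have := card_sup_dim_mul U (k - \dim U); rewrite subnKC //.
have [lekn|ltnk] := leqP (k - \dim U) (n - \dim U).
  rewrite -(qbinom_mul q_gt1 lekn) => /eqP; rewrite eqn_pmul2r => [/eqP//|].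
  by apply: prodn_gt0 => j; rewrite subn_gt0 (ltn_exp2l 0).
move=> _; rewrite /qbinom leqNgt ltnk /=; apply/eqP; rewrite cards_eq0.
apply/eqP/setP => V; rewrite !inE; apply/negP => /andP[_ /eqP dV].
by move: ltnk; rewrite ltnNge -dV leq_sub2r ?dimv_le_length.
Qed.

End Counting.

(** * Orthogonal complements and MDS codes *)

Section Dual.
Variables (F : finFieldType) (n : nat).
Implicit Types (U V W : {vspace 'rV[F]_n}) (v w x : 'rV[F]_n).

Definition basis_mx V : 'M[F]_(\dim V, n) := \matrix_i (vbasis V)`_i.

Definition perp V : {vspace 'rV[F]_n} := lker (linfun (mulmxr (basis_mx V)^T)).

Lemma mul_basis_mx V (c : 'rV_(\dim V)) :
  c *m basis_mx V = \sum_i c 0 i *: (vbasis V)`_i.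
Proof. by rewrite mulmx_sum_row; apply: eq_bigr => i _; rewrite rowK. Qed.

Lemma perpP V x : reflect (forall v, v \in V -> x *m v^T = 0) (x \in perp V).
Proof.
rewrite memv_ker lfunE /=; apply: (iffP eqP) => [xV v Vv | xV].
  have -> : v = (\row_i coord (vbasis V) i v) *m basis_mx V.
    rewrite mul_basis_mx {1}(coord_vbasis Vv).
    by apply: eq_bigr => i _; rewrite mxE.
  by rewrite trmx_mul mulmxA xV mul0mx.
apply/rowP => i; rewrite mxE.
have := xV _ (vbasis_mem (mem_nth 0 _ : (vbasis V)`_i \in vbasis V)).
rewrite size_tuple ltn_ord => /(_ isT) /matrixP/(_ 0 0); rewrite !mxE => xV0.
by rewrite -[RHS]xV0; apply: eq_bigr => j _; rewrite !mxE.
Qed.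

Lemma basis_mx_free V : row_free (basis_mx V).
Proof.
rewrite -kermx_eq0; apply/rowV0P => c /sub_kermxP; rewrite mul_basis_mx => c0.
apply/rowP => i; rewrite mxE.
by have /freeP/(_ (c 0) c0 i) := basis_free (vbasisP V).
Qed.

Lemma dim_perp V : \dim (perp V) = (n - \dim V)%N.
Proof.
rewrite /perp; set f := linfun _.
have [B BV] := row_freeP (basis_mx_free V).
have fT : limg f = fullv.
  apply/eqP; rewrite eqEsubv subvf /=; apply/subvP => y _; apply/memv_imgP.
  exists (y *m B^T); first exact: memvf.
  by rewrite lfunE /= -mulmxA -trmx_mul BV trmx1 mulmx1.
have := limg_ker_dim f fullv; rewrite fT capfv !dim_rV => dimE.
exact: (canRL (addnK _) dimE).
Qed.

Lemma perpK : involutive perp.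
Proof.
move=> V; apply/esym/eqP; rewrite eqEdim; apply/andP; split.
  apply/subvP => v Vv; apply/perpP => x /perpP/(_ v Vv) xv.
  by rewrite -[v *m _]trmxK trmx_mul trmxK xv trmx0.
by rewrite !dim_perp subKn ?dimv_le_length.
Qed.

Definition min_weight_gt e V : bool :=
  [forall v, (v \in V) && (hweight v <= e)%N ==> (v == 0)].

Lemma min_weight_gtP e V :
  reflect (forall v, v \in V -> (hweight v <= e)%N -> v = 0)
    (min_weight_gt e V).
Proof.
apply: (iffP forallP) => [H v Vv wv|H v].
  by apply/eqP/(implyP (H v))/andP.
by apply/implyP => /andP[Vv wv]; apply/eqP/H.
Qed.

(** Image of the injective map that spreads a vector indexed by S over the
positions in S; by its dimension it is the whole coordinate subspace of S. *)
Lemma coord_subspace (S : {set 'I_n}) :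
  exists2 E : {vspace 'rV[F]_n}, \dim E = #|S| &
    forall v, v \in E -> forall i, i \notin S -> v 0 i = 0.
Proof.
pose A : 'M[F]_(#|S|, n) := \matrix_(i, j) (enum_val i == j)%:R.
have AK : A *m A^T = 1%:M.
  apply/matrixP => i k; rewrite !mxE (bigD1 (enum_val i)) //= !mxE eqxx mul1r.
  rewrite big1 ?addr0 => [|j /negPf nji]; last by rewrite mxE eq_sym nji mul0r.
  by rewrite (inj_eq enum_val_inj) eq_sym.
exists (limg (linfun (mulmxr A))) => [|v /memv_imgP[u _ ->] j nSj].
  rewrite limg_dim_eq ?dim_rV //; apply/eqP; rewrite capfv -subv0.
  apply/subvP => u; rewrite memv_ker lfunE memv0 /= => /eqP uA0.
  by rewrite -[u]mulmx1 -AK mulmxA uA0 mul0mx.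
rewrite lfunE mxE big1 // => i _; rewrite mxE.
by case: eqP nSj => [<-|_ _]; rewrite ?enum_valP ?mulr0.
Qed.

(** Suppose w in the dual of V has weight at most n - d. It vanishes on some d
positions; let E be the subspace of words supported there. E has dimension d and
meets V trivially, so V + E is everything. Since w is orthogonal to V, and to E
because the supports are disjoint, w = 0. *)
Lemma min_weight_gt_perp d V : (d <= n)%N -> \dim V = (n - d)%N ->
  min_weight_gt d V -> min_weight_gt (n - d) (perp V).
Proof.
move=> led dV /min_weight_gtP Vd; apply/min_weight_gtP => w /perpP wV ww.
have /card_geqP[s [us ss sS]] : (d <= #|[set i | w 0%R i == 0%R]|)%N.
  have := cardsC [set i | w 0 i != 0]; rewrite card_ord => nE.
  rewrite -(leq_add2l (n - d)) subnK // -{1}nE leq_add //.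
  by apply/subset_leq_card/subsetP => i; rewrite !inE negbK.
have [E dE EP] := coord_subspace [set i in s].
have cardS : #|[set i in s]| = d by rewrite cardsE (card_uniqP us).
have VE0 : (V :&: E = 0)%VS.
  apply/eqP; rewrite -subv0; apply/subvP => v /memv_capP[Vv Ev]; rewrite memv0.
  apply/eqP/Vd => //; rewrite -cardS; apply/subset_leq_card/subsetP => i.
  by rewrite !inE; apply: contraR => nsi; apply/eqP/EP; rewrite ?inE.
have VEf : (V + E = fullv)%VS.
  apply/eqP; rewrite eqEdim subvf dimv_disjoint_sum // dim_rV dV dE cardS.
  by rewrite subnK ?leqnn.
have wE v : v \in E -> w *m v^T = 0.
  move=> /EP vE; apply/matrixP => a b; rewrite !ord1 !mxE big1 // => i _.
  rewrite mxE; have [/sS|nsi] := boolP (i \in s).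
    by rewrite inE => /eqP ->; rewrite mul0r.
  by rewrite vE ?mulr0 // inE.
apply/rowP => i; rewrite mxE.
have /memv_addP[v Vv [e Ee deltaE]] : delta_mx 0 i \in (V + E)%VS.
  by rewrite VEf memvf.
have : w *m (delta_mx 0 i : 'rV[F]_n)^T = 0.
  by rewrite deltaE linearD mulmxDr wV // wE // addr0.
by rewrite trmx_delta -colE => /matrixP/(_ 0 0); rewrite !mxE.
Qed.

Definition codes (k e : nat) :=
  [set V : {vspace 'rV[F]_n} | (\dim V == k) && min_weight_gt e V].

Lemma card_codes_dual d : (d <= n)%N -> #|codes (n - d) d| = #|codes d (n - d)|.
Proof.
move=> led; rewrite -(card_imset _ (inv_inj perpK)).
apply: eq_card => V.
rewrite -[V]perpK (mem_imset _ _ (inv_inj perpK)) !inE perpK.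
have leV := dimv_le_length V.
apply/andP/andP => [] [/eqP dV mV].
  have dP : \dim V = d by apply/eqP; rewrite -(eqn_sub2lE leV led) -dim_perp dV.
  split; first exact/eqP.
  by rewrite -[V]perpK min_weight_gt_perp.
split; first by rewrite dim_perp dV.
by rewrite -{1}(subKn led) min_weight_gt_perp ?leq_subr ?subKn.
Qed.

(** Orthogonality exchanges the subspaces of dimension k and n - k. *)
Lemma qbinom_sym k : (k <= n)%N -> qbinom #|F| n k = qbinom #|F| n (n - k).
Proof.
move=> lekn; have cardE l :
    qbinom #|F| n l = #|[set V : {vspace 'rV[F]_n} | \dim V == l]|.
  have := @card_sup_dim F n 0 l; rewrite dimv0 !subn0 => <- //.
  by apply: eq_card => V; rewrite !inE sub0v.
rewrite !cardE -(card_imset _ (inv_inj perpK)); apply: eq_card => V.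
rewrite -[V]perpK (mem_imset _ _ (inv_inj perpK)) !inE perpK dim_perp.
have leV := dimv_le_length V.
by apply/eqP/eqP => [<-//|/(congr1 (subn n))]; rewrite !subKn.
Qed.

End Dual.

(** * Codes counted by Whitney numbers *)

Section Mobius.
Variables (F : finFieldType) (n e : nat).
Implicit Types (V : {vspace 'rV[F]_n}) (U : hwd_lattice F n e).

(** Frees the basis from its tuple type and absorbs the separate case of the zero
space, whose basis is empty. *)
Lemma hwdP (V : {vspace 'rV[F]_n}) : reflect
  (exists2 b, basis_of V b & all (fun v => hweight v <= e)%N b)
  (low_weight_generated e V).
Proof.
apply: (iffP orP) => [[/eqP ->|/existsP[b /andP[Vb eb]]]|[b Vb eb]].
- by exists [::] => //; rewrite basisEdim span_nil dimv0 subvv.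
- by exists b.
- right; apply/existsP.
  have sb : size b == \dim V.
    by rewrite -(span_basis Vb) eq_sym; apply: (basis_free Vb).
  by exists (Tuple sb); rewrite /= Vb.
Qed.

Lemma hwd_add_line U v : v \notin val U -> (hweight v <= e)%N ->
  low_weight_generated e (<[v]> + val U)%VS.
Proof.
move=> nUv ev; have /hwdP[b Ub eb] := valP U.
apply/hwdP; exists (v :: b); last by rewrite /= ev.
rewrite /basis_of span_cons (span_basis Ub) eqxx free_cons (span_basis Ub) nUv.
exact: basis_free Ub.
Qed.

(** The members of the lattice below V form a principal ideal. Its generator M
is chosen of maximal dimension: by hwd_add_line, a low-weight word of V outside
M would enlarge M. So the sum runs over an interval from the bottom to M, and it
vanishes unless the interval is a point. *)
Lemma mobius_sum_sub V :
  \sum_(U : hwd_lattice F n e | (val U <= V)%VS) mobius (hwd0 F n e) U =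
  (min_weight_gt e V)%:Z.
Proof.
set o := hwd0 F n e.
have oV : (val o <= V)%VS by apply: sub0v.
have [M MV Mmax] := @arg_maxnP _ o
  (fun U : hwd_lattice F n e => (val U <= V)%VS) (fun U => \dim (val U)) oV.
have lowM v : v \in V -> (hweight v <= e)%N -> v \in val M.
  move=> Vv ev; apply: contraT => nMv.
  have := Mmax (Sub _ (hwd_add_line nMv ev)).
  rewrite SubK subv_add MV andbT -memvE Vv => /(_ isT).
  by rewrite /= addvC dim_add_line // ltnn.
have leM U : (val U <= V)%VS = (U <= M)%O.
  apply/idP/idP => [UV|UM]; last exact: subv_trans UM MV.
  have /hwdP[b Ub eb] := valP U.
  rewrite /Order.le /= /hwd_le -(span_basis Ub); apply/span_subvP => v bv.
  by rewrite lowM ?(allP eb) // (subvP UV) ?(basis_mem Ub).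
rewrite (eq_bigl _ _ leM); have [oM|neqoM] := eqVneq o M.
  rewrite -oM (big_pred1 o) ?mobiusxx => [|U]; last first.
    by rewrite /= eq_le [(o <= U)%O]hwd_le0x andbT.
  suff -> : min_weight_gt e V by [].
  apply/min_weight_gtP => v Vv ev; apply/eqP; rewrite -memv0.
  by have := lowM v Vv ev; rewrite -oM.
have ltoM : (o < M)%O by rewrite lt_neqAle neqoM [(_ <= _)%O]hwd_le0x.
have -> : min_weight_gt e V = false.
  apply: contraNF neqoM => /min_weight_gtP Ve; have /hwdP[b Mb eb] := valP M.
  rewrite eq_sym eq_le [(o <= M)%O]hwd_le0x andbT.
  rewrite /Order.le /= /hwd_le -(span_basis Mb); apply/span_subvP => v bv.
  by rewrite memv0 (Ve v) ?(allP eb) // (subvP MV) ?(basis_mem Mb).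
rewrite (bigD1 M) //= mobius_lt //; apply/eqP; rewrite addrC subr_eq0.
apply/eqP/eq_bigl => U.
by rewrite lt_neqAle [(o <= U)%O]hwd_le0x andbC.
Qed.

(** Moebius inversion: insert mobius_sum_sub for the indicator of a code,
exchange the sums, and group the lattice elements by dimension. *)
Lemma card_codes k :
  #|codes F n k e|%:Z =
  \sum_(0 <= i < k.+1) (qbinom #|F| (n - i) (k - i))%:Z * whitney F n e i.
Proof.
transitivity (\sum_(U : hwd_lattice F n e | (\dim (val U) <= k)%N)
  (qbinom #|F| (n - \dim (val U)) (k - \dim (val U)))%:Z *
    mobius (hwd0 F n e) U).
  transitivity (\sum_(V : {vspace 'rV[F]_n} | \dim V == k)
    \sum_(U : hwd_lattice F n e | (val U <= V)%VS) mobius (hwd0 F n e) U).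
    rewrite (eq_bigr _ (fun V _ => mobius_sum_sub V)) /codes -sum1dep_card.
    rewrite -natz natr_sum big_mkcondr /=.
    by apply: eq_bigr => V _; case: ifP.
  rewrite (exchange_big_dep (fun U => (\dim (val U) <= k)%N)) /=; last first.
    by move=> V U /eqP <-; apply: dimvS.
  apply: eq_bigr => U leUk; rewrite -card_sup_dim // -sum1dep_card.
  rewrite -natz natr_sum big_distrl /=.
  by apply: eq_big => [V|V _]; rewrite ?mul1r // andbC.
rewrite big_mkord; under [RHS]eq_bigr => i _ do rewrite /whitney big_distrr /=.
rewrite (exchange_big_dep
  (fun U : hwd_lattice F n e => (\dim (val U) <= k)%N)) /=.
  apply: eq_bigr => U leUk.
  by rewrite (big_pred1 (Ordinal (leUk : (\dim (val U) < k.+1)%N))).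
by move=> i U _ /eqP ->; rewrite -ltnS.
Qed.

End Mobius.

Theorem theorem6p7 (q : nat) (F : finFieldType) (cardF : #|F| = q)
    (n d : nat) (d_ge1 : (1 <= d)%N) (d_le_n : (d <= n)%N) :
  \sum_(0 <= i < (n - d).+1) (qbinom q (n - i) d)%:Z * whitney F n d i =
  \sum_(0 <= i < d.+1) (qbinom q (n - i) (d - i))%:Z * whitney F n (n - d) i.
Proof.
rewrite -cardF -card_codes -card_codes_dual // card_codes.
apply: eq_big_nat => i /andP[_]; rewrite ltnS => le_i; congr (_%:Z * _).
have le_in : (i <= n)%N by apply: leq_trans le_i (leq_subr d n).
have le_d : (d <= n - i)%N by rewrite leq_subRL // addnC -leq_subRL.
by rewrite (qbinom_sym _ le_d) subnAC.
Qed.
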